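(* Let $\mathbf{a}=(a_j)_{j\in\mathbb{N}}\in\Sigma$, and consider $\omega(\mathbf{a})=(\omega_j(\mathbf{a}))_{j\in\mathbb{N}}$ defined by $\omega_j(\mathbf{a})=\prod_{k=1}^{j}a_k^{-1}$ for all $j\in\mathbb{N}$. Then the closure of any orbit induced by the Kronecker flow $(\mathbb{T}^{\mathbb{N}},\Phi_{\omega(\mathbf{a})})$ is homeomorphic to the solenoid $\sigma_{\mathbf{a}}$.
   Context: $\mathbb{N}=\{1,2,\dots\}$, $\mathbb{T}=\mathbb{R}/2\pi\mathbb{Z}$, and $\mathbb{T}^{\mathbb{N}}$ carries the product topology. For $\omega\in\mathbb{R}^{\mathbb{N}}$ the Kronecker flow is $\Phi_\omega^t(\theta)=(\Theta_j+\omega_jt+2\pi\mathbb{Z})_{j\in\mathbb{N}}$, where $\theta_j=\Theta_j+2\pi\mathbb{Z}$. $\Sigma$ is the set of sequences $\mathbf{a}=(a_j)_{j\in\mathbb{N}}$ of natural numbers with $a_1=1$ and $a_j>1$ for all $j>1$. For $\mathbf{a}\in\Sigma$ the solenoid $\sigma_{\mathbf{a}}$ is the subgroup $\{\theta=(\Theta_j+2\pi\mathbb{Z})_{j\in\mathbb{N}}\in\mathbb{T}^{\mathbb{N}}:\Theta_j=a_{j+1}\Theta_{j+1}\bmod 2\pi\ \ \forall j\in\mathbb{N}\}$ with the subspace topology. *)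

(* Defs.v *)
From HB Require Import structures.
From mathcomp Require Import all_boot all_order all_algebra.
From mathcomp Require Import generic_quotient ring_quotient.
From mathcomp Require Import boolp classical_sets functions reals topology.
From mathcomp Require Import normedtype trigo.
Set Implicit Arguments.
Unset Strict Implicit.
Unset Printing Implicit Defensive.
Import Order.TTheory GRing.Theory Num.Theory numFieldNormedType.Exports.
Local Open Scope classical_set_scope.
Local Open Scope ring_scope.
Local Open Scope quotient_scope.

Section Circle.
Context {R : realType}.

Definition two_pi_int : {pred R} :=
  fun x => `[< exists k : int, x = 2 * pi * k%:~R >].

Lemma two_pi_int_zmod_closed : zmod_closed two_pi_int.
Proof.
split; first by apply/asboolP; exists 0; rewrite mulr0.
move=> x y /asboolP[k ->] /asboolP[l ->]; apply/asboolP.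
by exists (k - l); rewrite intrB mulrBr.
Qed.

HB.instance Definition _ :=
  GRing.isZmodClosed.Build R two_pi_int two_pi_int_zmod_closed.

End Circle.

Definition circle (R : realType) := Quotient.quot (@two_pi_int R).

HB.instance Definition _ (R : realType) :=
  Topological.copy (circle R) (quotient_topology (circle R)).
HB.instance Definition _ (R : realType) := Quotient.on (circle R).

(* In all sequences below, the index j : nat stands for the position j + 1 of
   a sequence indexed by the positive integers. *)

Definition torus (R : realType) : topologicalType := {ptws nat -> circle R}.

(* Independent of the choice of representatives: see kronecker_flowE. *)
Definition kronecker_flow (R : realType) (w : nat -> R) (t : R)
    (theta : torus R) : torus R :=
  fun j => \pi_(circle R) (repr (theta j) + w j * t).

Lemma circle_eqP (R : realType) (x y : R) :
  x = y %[mod circle R] <-> exists k : int, x - y = 2 * pi * k%:~R.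
Proof.
have E : (x == y %[mod Quotient.quot (@two_pi_int R)]) =
    `[< exists k : int, x - y = 2 * pi * k%:~R >].
  by rewrite -Quotient.idealrBE.
split=> [xy|xy]; first by apply/asboolP; rewrite -E; apply/eqP.
by apply: (@eqP (Quotient.quot (@two_pi_int R))); rewrite E; apply/asboolP.
Qed.

Lemma kronecker_flowE (R : realType) (w : nat -> R) (t : R) (Theta : nat -> R) :
  kronecker_flow w t (fun j => \pi_(circle R) (Theta j)) =
  (fun j => \pi_(circle R) (Theta j + w j * t)).
Proof.
apply/funext => j; apply/circle_eqP.
by rewrite opprD addrACA subrr addr0; apply/circle_eqP; rewrite reprK.
Qed.

Definition kronecker_orbit (R : realType) (w : nat -> R) (theta : torus R) :
    set (torus R) :=
  range (fun t : R => kronecker_flow w t theta).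

Definition Sigma : set (nat -> nat) :=
  [set a | a 0%N = 1%N /\ forall j, (0 < j)%N -> (1 < a j)%N].

Definition solenoid_freq (R : realType) (a : nat -> nat) (j : nat) : R :=
  \prod_(k < j.+1) (a k)%:R^-1.

Definition solenoid (R : realType) (a : nat -> nat) : set (torus R) :=
  [set theta | exists Theta : nat -> R,
    (forall j, theta j = \pi_(circle R) (Theta j)) /\
    (forall j, Theta j = (a j.+1)%:R * Theta j.+1 %[mod circle R])].
Arguments solenoid : clear implicits.

Definition homeomorphic (X Y : topologicalType) : Prop :=
  exists (f : X -> Y) (g : Y -> X),
    [/\ continuous f, continuous g, cancel f g & cancel g f].

(* Main.v *)
Require Import Defs.
From mathcomp Require Import all_boot all_order all_algebra.
From mathcomp Require Import generic_quotient boolp classical_sets functions.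
From mathcomp Require Import reals topology normedtype trigo.
Import Order.TTheory GRing.Theory Num.Theory numFieldNormedType.Exports.
Local Open Scope classical_set_scope.
Local Open Scope ring_scope.
Local Open Scope quotient_scope.
Set Implicit Arguments.
Unset Strict Implicit.
Unset Printing Implicit Defensive.

(** Translation by [theta] is a homeomorphism of the torus.  It carries the
orbit of the identity element, that is, the one-parameter subgroup
[t |-> (w_j t)_j], onto the orbit of [theta], so it is enough to see that the
closure of this subgroup is the solenoid itself.

The subgroup lies in the solenoid because [w_j = a_(j+1) w_(j+1)]
([line_solenoid]).  The solenoid is closed because each of its defining
equations equates two continuous maps into the circle, which is Hausdorff
([closed_solenoid]).

The subgroup is dense in the solenoid because a point [x] of the solenoid is
determined up to the index [N] by its single coordinate [x_N]: the earlier
coordinates are multiples of it.  As [w_N] is not zero, the time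
[t = x_N / w_N] reaches [x_N], and then the subgroup agrees with [x] exactly
at all indices up to [N] ([solenoid_agree]).  Letting [N] grow gives a
sequence in the subgroup converging to [x] in the product topology
([solenoid_sub_closure]).

Translation by [theta] needs no separate construction: it is the Kronecker
flow at time 1 whose frequencies are real representatives of the coordinates
of [theta], and its inverse is the same flow at time -1. *)

(** * Topological generalities *)

Lemma homeomorphic_sets (X : topologicalType) (A B : set X) (f g : X -> X) :
  continuous f -> continuous g -> cancel f g -> cancel g f ->
  {homo f : x / A x >-> B x} -> {homo g : x / B x >-> A x} ->
  homeomorphic (set_type A) (set_type B).
Proof.
move=> cf cg fK gK fAB gBA.
exists (fun x : set_type A => SigSub (mem_set (fAB _ (set_valP x)))).
exists (fun x : set_type B => SigSub (mem_set (gBA _ (set_valP x)))).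
split.
- apply: continuous_comp_initial => x.
  apply: (@continuous_comp _ _ _ set_val f); last exact: cf.
  exact: initial_continuous.
- apply: continuous_comp_initial => x.
  apply: (@continuous_comp _ _ _ set_val g); last exact: cg.
  exact: initial_continuous.
- by move=> x; apply: val_inj; rewrite /= fK.
- by move=> x; apply: val_inj; rewrite /= gK.
Qed.

(** The product topology is a supremum of initial topologies, so convergence
can be tested on the projections. *)
Lemma ptws_cvgP (I : Type) (T : topologicalType) (F : set_system (I -> T))
    (x : I -> T) : Filter F ->
  {ptws, F --> x} <-> forall i, (fun g => g i) @ F --> x i.
Proof.
move=> FF; rewrite cvg_sup; split=> + i => /(_ i) Fx.
  by move=> U /(@initial_continuous _ _ (fun g : I -> T => g i) x) /Fx.
move=> U [_ [[V oV <-] Vx]] /filterS; apply.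
by apply: (Fx V); exact: open_nbhs_nbhs.
Qed.

Lemma closed_eqlocus (X Y : topologicalType) (f g : X -> Y) :
  hausdorff_space Y -> continuous f -> continuous g ->
  closed [set x | f x = g x].
Proof.
move=> hY cf cg x clx; apply: hY => U V fU gV.
have [y [/= fg [Uy Vy]]] := clx _ (@filterI _ (nbhs x) _ (f @^-1` U) (g @^-1` V)
  (cf _ _ fU) (cg _ _ gV)).
by exists (f y); split=> //; rewrite fg.
Qed.

(** * The circle as a quotient of the line *)

Section Circle.
Context {R : realType}.
Implicit Types x y : R.

Lemma circle_pi_continuous : continuous \pi_(circle R).
Proof. exact: pi_continuous. Qed.

(** The saturation of an open set is the union of its translates by multiples
of [2 pi]. *)
Lemma circle_pi_open (U : set R) : open U -> open (\pi_(circle R) @` U).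
Proof.
move=> oU.
change (open (\pi_(circle R) @^-1` (\pi_(circle R) @` U))).
have -> : \pi_(circle R) @^-1` (\pi_(circle R) @` U) =
    \bigcup_(k : int) (fun x => x + 2 * pi * k%:~R) @^-1` U.
  apply/seteqP; split=> [x [u Uu /circle_eqP[k uxk]]|x [k _ Uxk]].
    by exists k => //=; rewrite -uxk addrC subrK.
  exists (x + 2 * pi * k%:~R) => //; apply/circle_eqP; exists k.
  by rewrite addrC addKr.
apply: bigcup_open => k _; apply: open_comp => // x _.
by apply: (@cvgD _ R); [exact: cvg_id|exact: cvg_cst].
Qed.

Lemma circle_pi_nbhs x (U : set R) :
  nbhs x U -> nbhs (\pi_(circle R) x) (\pi_(circle R) @` U).
Proof.
rewrite nbhsE => -[V [oV Vx] VU].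
apply: (filterS (@image_subset _ _ \pi_(circle R) _ _ VU)).
by apply: open_nbhs_nbhs; split; [exact: circle_pi_open|exists x].
Qed.

Lemma closed_two_pi_int :
  closed [set x : R | exists k : int, x = 2 * pi * k%:~R].
Proof.
have p0 : 0 < 2 * pi :> R by rewrite mulr_gt0 ?pi_gt0.
rewrite -openC openE => x /= xN.
set m := Num.floor (x / (2 * pi)).
have := floor_itv (x / (2 * pi)); rewrite ler_pdivlMr// ltr_pdivrMr// -/m.
move=> /andP[mx xm].
(* [x] lies strictly between two consecutive multiples of [2 pi] *)
have mx' : 2 * pi * m%:~R < x.
  rewrite lt_neqAle mulrC mx andbT; apply/eqP => e; apply: xN.
  by exists m; rewrite mulrC.
near=> y; move=> [k yk].
have : m%:~R * (2 * pi) < k%:~R * (2 * pi) :> R.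
  rewrite -[ltRHS]mulrC -yk mulrC; near: y; exact: lt_nbhsr.
have : k%:~R * (2 * pi) < (m + 1)%:~R * (2 * pi) :> R.
  rewrite -[ltLHS]mulrC -yk; near: y; exact: lt_nbhsl.
rewrite !ltr_pM2r// !ltr_int ltzD1 => km mk.
by have := le_lt_trans km mk; rewrite ltxx.
Unshelve. all: by end_near. Qed.

(** Two distinct points lift to reals [x], [y] whose difference avoids the
closed set of multiples of [2 pi].  By continuity of subtraction so do all
differences of reals near [x] and [y], and since the projection is open these
neighbourhoods descend to disjoint neighbourhoods in the circle. *)
Lemma hausdorff_circle : hausdorff_space (circle R).
Proof.
move=> c d; rewrite -[c]reprK -[d]reprK; set x := repr c; set y := repr d.
move=> cd; apply: contrapT => /circle_eqP xNy.
have [[U V] /= [xU yV] UV] : nbhs (x, y) ((fun z : R * R => z.1 - z.2) @^-1`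
    (~` [set z : R | exists k : int, z = 2 * pi * k%:~R])).
  apply: (@sub_continuous R (x, y)); apply: open_nbhs_nbhs; split=> //.
  by rewrite openC; exact: closed_two_pi_int.
have [_ [[u Uu <-] [v Vv /esym/circle_eqP uv]]] :=
  cd _ _ (circle_pi_nbhs xU) (circle_pi_nbhs yV).
exact: (UV (u, v)).
Qed.

(** The affine map [x |-> n x + s] descends to the circle.  The translations
([n = 1]) are the coordinates of the flow, the multiplications ([s = 0]) are
the bonding maps of the solenoid. *)
Lemma circle_affineE n s x :
  \pi_(circle R) (n%:R * repr (\pi_(circle R) x) + s) =
  \pi_(circle R) (n%:R * x + s).
Proof.
have /circle_eqP[k xk] := reprK (\pi_(circle R) x).
apply/circle_eqP; exists (k * n%:Z).
by rewrite opprD addrACA subrr addr0 -mulrBr xk intrM mulrC mulrA.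
Qed.

Lemma circle_affine_continuous n (s : R) :
  continuous (fun c : circle R => \pi_(circle R) (n%:R * repr c + s)).
Proof.
apply: (@repr_comp_continuous _ _ _ (fun x => \pi_(circle R) (n%:R * x + s))).
  move=> x; apply: (@continuous_comp _ _ _ (fun x => n%:R * x + s)).
    by apply: cvgD; [exact: mulrl_continuous|exact: cvg_cst].
  exact: circle_pi_continuous.
move=> x y /eqP xy; apply/eqP.
by rewrite -circle_affineE xy circle_affineE.
Qed.

End Circle.

(** * The Kronecker flow and the solenoid *)

Section Flow.
Context {R : realType}.
Implicit Types (w : nat -> R) (x theta : torus R) (a : nat -> nat).

Lemma kronecker_flow_continuous w t : continuous (@kronecker_flow R w t).
Proof.
move=> x; have FF := fmap_filter (kronecker_flow w t) (nbhs_filter x).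
apply/(ptws_cvgP _ FF) => i.
have flow_i : (fun g : torus R => kronecker_flow w t g i) =
    (fun c : circle R => \pi_(circle R) (1%:R * repr c + w i * t)) \o
    (fun g : torus R => g i).
  by apply/funext => g /=; rewrite /kronecker_flow mul1r.
suff /(_ x) : continuous (fun g : torus R => kronecker_flow w t g i) by [].
rewrite flow_i => y.
apply: continuous_comp; last exact: circle_affine_continuous.
exact: (@proj_continuous _ (fun=> circle R)).
Qed.

Lemma repr_torus x : x = (fun j => \pi_(circle R) (repr (x j))).
Proof. by apply/funext => j; rewrite reprK. Qed.

Lemma kronecker_flowK w t :
  cancel (@kronecker_flow R w t) (kronecker_flow w (- t)).
Proof.
move=> x; rewrite [x]repr_torus !kronecker_flowE; apply/funext => j.
by rewrite mulrN addrK.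
Qed.

(** Any lifts of the coordinates may be used to test the defining equations,
since multiplication by an integer is well defined on the circle. *)
Lemma solenoidP a x : solenoid R a x <->
  forall j, x j = \pi_(circle R) ((a j.+1)%:R * repr (x j.+1)).
Proof.
split=> [[T [xT aT]] j|xa].
  rewrite !xT aT; have := circle_affineE (a j.+1) 0 (T j.+1).
  by rewrite !addr0 => ->.
exists (fun j => repr (x j)); split=> j; first by rewrite reprK.
by rewrite reprK.
Qed.

Lemma closed_solenoid a : closed (solenoid R a).
Proof.
have -> : solenoid R a = \bigcap_(j : nat)
    [set x | x j = \pi_(circle R) ((a j.+1)%:R * repr (x j.+1) + 0)].
  apply/seteqP; split=> x.
    by move=> /solenoidP xa j _ /=; rewrite addr0.
  by move=> xa; apply/solenoidP => j; rewrite (xa j I) addr0.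
apply: closed_bigI => j _; apply: closed_eqlocus.
- exact: hausdorff_circle.
- exact: proj_continuous.
- move=> x; apply: (@continuous_comp _ _ _ (fun g : torus R => g j.+1)
    (fun c : circle R => \pi_(circle R) ((a j.+1)%:R * repr c + 0))).
    exact: proj_continuous.
  exact: circle_affine_continuous.
Qed.

Lemma solenoid_freqS a j : (0 < a j.+1)%N ->
  @solenoid_freq R a j = (a j.+1)%:R * solenoid_freq R a j.+1.
Proof.
move=> a0; rewrite /solenoid_freq [in RHS]big_ord_recr /= mulrCA mulfV ?mulr1//.
by rewrite pnatr_eq0 -lt0n.
Qed.

(** Reduces the orbit of [theta] to the one-parameter subgroup through the
identity; the translation by [theta] is written as a flow at time 1. *)
Lemma kronecker_flow_rebase w t theta :
  kronecker_flow w t theta =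
  kronecker_flow (fun j => repr (theta j)) 1
    (fun j => \pi_(circle R) (w j * t)).
Proof.
by rewrite kronecker_flowE; apply/funext => j; rewrite mulr1 addrC.
Qed.

Lemma line_solenoid a t : (forall j, (0 < a j)%N) ->
  solenoid R a (fun j => \pi_(circle R) (solenoid_freq R a j * t)).
Proof.
move=> a0; exists (fun j => solenoid_freq R a j * t); split=> // j.
by rewrite solenoid_freqS// mulrA.
Qed.

(** Going down from index [j + 1] to [j] multiplies both sides by [a_(j+1)]. *)
Lemma solenoid_agree a x t N : (forall j, (0 < a j)%N) ->
  solenoid R a x -> x N = \pi_(circle R) (solenoid_freq R a N * t) ->
  forall j, (j <= N)%N -> x j = \pi_(circle R) (solenoid_freq R a j * t).
Proof.
move=> a0 /solenoidP xa; elim: N => [|N IH] xN j.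
  by rewrite leqn0 => /eqP ->.
rewrite leq_eqVlt => /predU1P[->//|]; rewrite ltnS; apply: IH.
have := circle_affineE (a N.+1) 0 (solenoid_freq R a N.+1 * t).
by rewrite xa xN !addr0 mulrA -solenoid_freqS.
Qed.

Lemma solenoid_sub_closure a : (forall j, (0 < a j)%N) ->
  solenoid R a `<=`
  closure (range (fun t j => \pi_(circle R) (solenoid_freq R a j * t))
    : set (torus R)).
Proof.
move=> a0 x xa.
have /choice[t xt] : forall N, exists t, forall j, (j <= N)%N ->
    x j = \pi_(circle R) (solenoid_freq R a j * t).
  move=> N; exists (repr (x N) / solenoid_freq R a N).
  apply: solenoid_agree => //; rewrite mulrC divfK ?reprK//.
  by apply/prodf_neq0 => k _; rewrite invr_eq0 pnatr_eq0 -lt0n.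
pose z N : torus R := fun j => \pi_(circle R) (solenoid_freq R a j * t N).
have zx : z @ \oo --> x.
  apply/ptws_cvgP => j; apply: cvg_near_cst.
  by exists j => // N /= jN; rewrite /z -xt.
apply: (@closed_cvg _ (torus R) _ _ z _ (@closed_closure _ _) _ x zx).
by apply: nearW => N; apply: subset_closure; exists (t N).
Qed.

End Flow.

Theorem theorem4p7 (R : realType) (a : nat -> nat) (aS : Sigma a)
    (theta : torus R) :
  homeomorphic
    (set_type (closure (kronecker_orbit (@solenoid_freq R a) theta)))
    (set_type (solenoid R a)).
Proof.
have a0 j : (0 < a j)%N.
  by case: j => [|j]; [rewrite aS.1|exact: ltnW (aS.2 _ _)].
pose T j := repr (theta j).
have TK : cancel (kronecker_flow T (- 1)) (kronecker_flow T 1).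
  by have := kronecker_flowK T (- 1); rewrite opprK.
apply: (homeomorphic_sets (f := kronecker_flow T (- 1))
                          (g := kronecker_flow T 1)) => //.
- exact: kronecker_flow_continuous.
- exact: kronecker_flow_continuous.
- exact: kronecker_flowK.
- pose E := kronecker_flow T (- 1) @^-1` solenoid R a.
  have cE : closed E.
    apply: preimage_closed; last exact: closed_solenoid.
    by move=> x _; exact: kronecker_flow_continuous.
  suff orbE : kronecker_orbit (solenoid_freq R a) theta `<=` E.
    by move=> x /(closureS orbE); rewrite -((closure_id E).1 cE).
  move=> _ [t _ <-]; rewrite /E /=.
  rewrite (kronecker_flow_rebase _ _ theta) kronecker_flowK.
  exact: line_solenoid.
- move=> x /(solenoid_sub_closure a0) clx B /kronecker_flow_continuous /clx.
  move=> [_ [[t _ <-] Bt]]; exists (kronecker_flow (solenoid_freq R a) t theta).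
  by split; [exists t|rewrite kronecker_flow_rebase].
Qed.
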